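(* Let $k\ge2$, $\lambda>0$ and let $\nu$ be a probability measure on $\mathcal{P}_{\mathrm m}^{(k)}$ non-degenerate at $(1,0,\ldots,0)$. A (continuous-time) $\mathrm{CP}(\nu)$-ancestral branching Markov process $(T(t),t\ge0)$ on $\mathcal{T}^{(k)}$, with semigroup $\mathbb{P}_t\varphi(\tau):=\mathbb{E}_\tau\varphi(T(t))$, has the Feller property, i.e. for each continuous function $\varphi:\mathcal{T}^{(k)}\to\mathbb{R}$: (i) for each $\tau\in\mathcal{T}^{(k)}$, $\lim_{t\downarrow0}\mathbb{P}_t\varphi(\tau)=\varphi(\tau)$; (ii) for all $t>0$, $\tau\mapsto\mathbb{P}_t\varphi(\tau)$ is continuous.
   Context: Trees: a fragmentation tree of $A\subseteq\mathbb{N}$ is a collection $T$ of non-empty subsets of $A$ with $A\in T$ (the root), containing all singletons, any two elements being disjoint or nested. The parent of $t\neq A$ is the smallest element of $T$ strictly containing $t$; children of $t$ are the elements with parent $t$; for finite $A$ with $\#A\ge 2$, the root partition $\Pi_T$ is the set of children of the root. $T_{|S}=\{t\cap S:t\in T\}\setminus\{\emptyset\}$. $\mathcal{T}_n^{(k)}$: fragmentation trees of $[n]=\{1,\dots,n\}$ with at most $k$ children per vertex; $\mathcal{T}^{(k)}$: the corresponding space for $\mathbb{N}$, elements being identified with compatible sequences of restrictions $(T_{|[n]},n\ge1)$, equipped with the metric $d(T,T')=1/\max\{n:T_{|[n]}=T'_{|[n]}\}$ ($1/\infty=0$). $\mathbf{1}_b=\{b\}$. $\mathcal{P}_{\mathrm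 m}^{(k)}=\{s=(s_1\ge s_2\ge\dots\ge0): s_j=0\ \forall j>k,\ \sum_j s_j=1\}$. The paintbox $\varrho_s$ is the law of the random partition of $\mathbb{N}$ with $i\sim j$ iff $X_i=X_j$, $X_1,X_2,\dots$ i.i.d. with $P(X_i=j)=s_j$; $\varrho_\nu=\int\varrho_s\,\nu(ds)$; for a partition $\sigma$ of a finite set $c$, $\varrho_\nu(\sigma)$ is the probability that a $\varrho_\nu$-partition restricted to $c$ equals $\sigma$. For finite $b$ and partitions $\pi,\pi'$ of $b$ with at most $k$ blocks, $$p_b(\pi,\pi';\nu)=\frac{k!}{(k-\#\pi')!}\prod_{c\in\pi}\frac{(k-\#\pi'_{|c})!}{k!}\varrho_\nu(\pi'_{|c}),\quad Q_n(T,T';\nu)=\prod_{b\in T':\#b\ge2}\frac{p_b(\Pi_{T_{|b}},\Pi_{T'_{|b}};\nu)}{1-p_b(\Pi_{T_{|b}},\mathbf{1}_b;\nu)}.$$ A $\mathrm{CP}(\nu)$-ancestral branching Markov process is a Markov process $(T(t),t\ge0)$ on $\mathcal{T}^{(k)}$ such that for each $n$ the restriction $(T_{|[n]}(t),t\ge0)$ is a Markov process on $\mathcal{T}_n^{(k)}$ with jump rates $\lambda Q_n(T,T';\nu)$ for $T\ne T'$. $\mathbb{E}_\tau$ is expectation given $T(0)=\tau$. *)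

(* Defs.v *)
From HB Require Import structures.
From mathcomp Require Import all_boot all_order all_algebra finmap.
From mathcomp Require Import all_classical all_reals all_analysis.
From mathcomp Require Import measurable_realfun.

Set Implicit Arguments.
Unset Strict Implicit.
Unset Printing Implicit Defensive.

Import Order.TTheory GRing.Theory Num.Theory.
Import numFieldNormedType.Exports.

Local Open Scope fset_scope.
Local Open Scope nat_scope.

Definition interval_fset (n : nat) : {fset nat} := [fset i | i in iota 1 n].

(* Vertices are finite sets of positive integers; a collection of them serves
   both as a tree and as a set partition (of its union). *)
Definition restrict_sets (T : {fset {fset nat}}) (S : {fset nat}) :
    {fset {fset nat}} :=
  [fset t `&` S | t in T] `\ fset0.

Definition is_fragmentation_tree (A : {fset nat}) (T : {fset {fset nat}}) :
    bool :=
  [&& A \in T,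
      all (fun t : {fset nat} => (t != fset0) && (t `<=` A)) T,
      all (fun a => [fset a] \in T) A &
      all (fun t : {fset nat} => all (fun u : {fset nat} =>
        [|| t `<=` u, u `<=` t | fdisjoint t u]) T) T].

Definition is_parent (T : {fset {fset nat}}) (p t : {fset nat}) : bool :=
  [&& p \in T, t `<` p &
      all (fun u : {fset nat} => (t `<` u) ==> (p `<=` u)) T].

Definition children (T : {fset {fset nat}}) (p : {fset nat}) :
    {fset {fset nat}} :=
  [fset t in T | is_parent T p t].

Definition is_ktree (k : nat) (A : {fset nat}) (T : {fset {fset nat}}) : bool :=
  is_fragmentation_tree A T &&
  all (fun t : {fset nat} => #|` children T t| <= k) T.

(* $\mathcal{T}_n^{(k)}$ *)
Definition ktrees (k n : nat) : {fset {fset {fset nat}}} :=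
  [fset T in fpowerset (fpowerset (interval_fset n))
     | is_ktree k (interval_fset n) T].

(* $\Pi_{T_{|b}}$; the root of $T_{|b}$ is $b$. *)
Definition root_partition (T : {fset {fset nat}}) (b : {fset nat}) :
    {fset {fset nat}} :=
  children (restrict_sets T b) b.

(* $\mathcal{T}^{(k)}$ as compatible sequences of finite trees. The entry of
   index 0 carries no information: compatibility forces it to be empty.
   [R] is the field in which distances take their values; together with the
   proof that $k\ge2$ (which makes the space nonempty) it is kept as a
   parameter so that the metric and Borel structures can be inferred. *)
Record ktree (R : realType) (k : nat) (k2 : 1 < k) := KTree {
  tree_at :> nat -> {fset {fset nat}} ;
  tree_atP : forall n, 0 < n -> is_ktree k (interval_fset n) (tree_at n) ;
  tree_at_compat : forall m n, m <= n ->
    restrict_sets (tree_at n) (interval_fset m) = tree_at m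
}.

Lemma in_interval (n i : nat) : (i \in interval_fset n) = (0 < i <= n).
Proof. by rewrite !inE mem_iota add1n ltnS. Qed.

Lemma in_restrict_sets (T : {fset {fset nat}}) (S u : {fset nat}) :
  (u \in restrict_sets T S) <-> u != fset0 /\ exists2 t, t \in T & u = t `&` S.
Proof.
rewrite /restrict_sets in_fsetD1; split.
  by move=> /andP[-> /imfsetP[t /= tT ->]]; split => //; exists t.
by move=> [-> [t tT ->]]; apply/imfsetP; exists t.
Qed.

Lemma ktree_inj (R : realType) (k : nat) (k2 : 1 < k) (T T' : ktree R k2) :
  (forall n, 0 < n -> T n = T' n) -> T = T'.
Proof.
move=> TT'; have {}TT' : tree_at T = tree_at T'.
  apply/funext => -[|n]; last exact: TT'.
  by rewrite -(tree_at_compat T (leq0n 1)) -(tree_at_compat T' (leq0n 1)) TT'.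
by case: T T' TT' => [f fP fC] [g gP gC] /= fg; subst g; f_equal;
  exact: Prop_irrelevance.
Qed.

(* The comb (caterpillar) tree inhabits $\mathcal{T}^{(k)}$. *)
Definition tail_fset (n j : nat) : {fset nat} :=
  [fset i in interval_fset n | j <= i].

Definition comb (n : nat) : {fset {fset nat}} :=
  [fset tail_fset n j | j in interval_fset n]
  `|` [fset [fset j] | j in interval_fset n].

Lemma in_tail n j i : (i \in tail_fset n j) = (0 < i <= n) && (j <= i).
Proof. by rewrite !inE mem_iota add1n ltnS. Qed.

Lemma in_comb n t : (t \in comb n) <->
  exists2 j, 0 < j <= n & t = tail_fset n j \/ t = [fset j].
Proof.
rewrite in_fsetU; split.
  by case/orP => /imfsetP[j /=]; rewrite in_interval => jn ->;
    exists j => //; [left|right].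
move=> [j jn [->|->]]; apply/orP; [left|right];
  by apply/imfsetP; exists j => //=; rewrite in_interval.
Qed.

Lemma comb_compat m n : m <= n ->
  restrict_sets (comb n) (interval_fset m) = comb m.
Proof.
move=> mn.
have tailI j : tail_fset n j `&` interval_fset m = tail_fset m j.
  apply/fsetP => i; rewrite in_fsetI !in_tail in_interval.
  case: (j <= i); rewrite ?andbF ?andbT //.
  case: (0 < i) => //=; case: (leqP i m) => // im; last by rewrite andbF.
  by rewrite (leq_trans im mn).
have oneI j : [fset j] `&` interval_fset m =
              if 0 < j <= m then [fset j] else fset0.
  case: ifP => jm; apply/fsetP => i; rewrite in_fsetI in_interval !inE;
    by case: eqP => //= ->.
apply/fsetP => u; apply/idP/idP.
  move=> /in_restrict_sets[u0 [t /in_comb[j /andP[j0 jn] [->|->]] uE]].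
    rewrite tailI in uE; move/fset0Pn: u0 => [i]; rewrite uE in_tail.
    move=> /andP[/andP[i0 im] ji]; apply/in_comb; exists j; last by left.
    by rewrite j0 (leq_trans ji).
  rewrite oneI in uE; move: uE u0; case: ifP => [jm -> _|_ ->].
    by apply/in_comb; exists j => //; right.
  by rewrite eqxx.
move=> /in_comb[j jm uE]; have /andP[j0 jlem] := jm.
have jn : 0 < j <= n by rewrite j0 (leq_trans jlem).
apply/in_restrict_sets; case: uE => ->; split.
- by apply/fset0Pn; exists j; rewrite in_tail jm leqnn.
- exists (tail_fset n j); rewrite ?tailI//.
  by apply/in_comb; exists j => //; left.
- by apply/fset0Pn; exists j; rewrite inE.
- by exists [fset j]; rewrite ?oneI ?jm//; apply/in_comb; exists j => //; right.
Qed.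

Lemma comb_ktree k n : 1 < k -> 0 < n -> is_ktree k (interval_fset n) (comb n).
Proof.
move=> k2 n0; have tail1 : tail_fset n 1 = interval_fset n.
  apply/fsetP => i; rewrite in_tail in_interval.
  by case: (0 < i); rewrite /= ?andbT ?andbF.
apply/andP; split; first apply/and4P; first split.
- by apply/in_comb; exists 1; [rewrite n0|left].
- apply/allP => t /in_comb[j jn [->|->]]; apply/andP; split.
  + by apply/fset0Pn; exists j; rewrite in_tail jn leqnn.
  + by apply/fsubsetP => i; rewrite in_tail in_interval => /andP[].
  + by apply/fset0Pn; exists j; rewrite inE.
  + by apply/fsubsetP => i; rewrite inE in_interval => /eqP->.
- apply/allP => j; rewrite in_interval => jn.
  by apply/in_comb; exists j => //; right.
- have tailS i j : i <= j -> tail_fset n j `<=` tail_fset n i.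
    move=> ij; apply/fsubsetP => l; rewrite !in_tail => /andP[-> jl] /=.
    exact: leq_trans jl.
  apply/allP => t /in_comb[i _ ti]; apply/allP => u /in_comb[j _ uj].
  have one l (B : {fset nat}) : [fset l] `<=` B \/ fdisjoint [fset l] B.
    by rewrite fsub1set fdisjoint1X; case: (l \in B); [left|right].
  case: ti => ->.
    case: uj => ->.
      by case/orP: (leq_total i j) => /tailS ->; rewrite ?orbT.
    case: (one j (tail_fset n i)) => h; first by rewrite h orbT.
    by rewrite fdisjoint_sym h !orbT.
  by case: (one i u) => -> //; rewrite !orbT.
apply/allP => t /in_comb[i /andP[i0 i_le_n] tE]; apply: leq_trans k2.
suff: children (comb n) t `<=` [fset [fset i]; tail_fset n i.+1].
  move=> /fsubset_leq_card /leq_trans; apply.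
  by rewrite cardfs2; case: (_ == _).
apply/fsubsetP => _ /imfsetP[c /= /andP[cT /and3P[_ ct /allP cmin]] ->].
rewrite in_fset2; case/in_comb : cT => j jn cE.
have cj : j \in c by case: cE => ->; rewrite ?in_tail ?inE ?leqnn ?jn.
have jt : j \in t by move/fproper_sub/fsubsetP : ct; apply.
case: tE => tE; last first.
  exfalso; move: jt ct; rewrite tE inE => /eqP ji.
  by rewrite fproperE fsub1set -ji cj andbF.
move: (jt); rewrite tE in_tail => /andP[_].
rewrite leq_eqVlt => /predU1P[ij|ij].
  case: cE => cE; last by rewrite cE ij eqxx.
  by move: ct; rewrite cE tE ij fproperE fsubset_refl.
apply/orP; right; apply: contraT => cneq; exfalso.
have tailC : tail_fset n i.+1 \in comb n.
  by apply/in_comb; exists i.+1; [case/andP: jn => _; apply: leq_trans|left].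
have csub : c `<` tail_fset n i.+1.
  rewrite fproperEneq cneq; apply/fsubsetP => l lc; rewrite in_tail.
  case: cE => cE; move: lc; rewrite cE ?in_tail ?inE.
    by move=> /andP[-> jl]; rewrite (leq_trans ij).
  by move=> /eqP->; rewrite jn.
have /implyP/(_ csub)/fsubsetP/(_ i) := cmin _ tailC.
by rewrite tE !in_tail ltnn andbF i0 i_le_n leqnn => /(_ isT).
Qed.

Local Close Scope nat_scope.
Local Close Scope fset_scope.
Local Open Scope classical_set_scope.
Local Open Scope ring_scope.

Section tree_metric.
Context (R : realType) (k : nat) (k2 : (1 < k)%N).
Implicit Types T : ktree R k2.

(* The supremum equals the maximum unless [T = T'], when it is [+oo], whose
   inverse is 0. *)
Definition tree_dist T T' : R :=
  fine ((ereal_sup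
    [set n%:R%:E | n in [set n : nat | (0 < n)%N /\ T n = T' n]])^-1)%E.

Lemma agree_le T T' m n : (m <= n)%N -> T n = T' n -> T m = T' m.
Proof. by move=> mn E; rewrite -(tree_at_compat T mn) E tree_at_compat. Qed.

Lemma agree1 T T' : T 1%N = T' 1%N.
Proof.
suff H T0 : T0 1%N = [fset [fset 1%N]]%fset by rewrite (H T) (H T').
have /andP[/and4P[A1 /allP Tsub _ _] _] := tree_atP T0 (ltn0Sn 0).
have i1 : interval_fset 1 = [fset 1%N]%fset.
  by apply/fsetP => i; rewrite in_interval inE andbC -eqn_leq.
rewrite i1 in A1 Tsub; apply/fsetP => t; rewrite inE.
apply/idP/eqP => [/Tsub|->//]; rewrite fsubset1.
by case/andP=> /negbTE ->; rewrite orbF => /eqP.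
Qed.

Let agreement T T' : \bar R :=
  ereal_sup [set n%:R%:E | n in [set n | (0 < n)%N /\ T n = T' n]].

Lemma agreement_ge1 T T' : (1 <= agreement T T')%E.
Proof.
by apply: ereal_sup_ubound; exists 1%N => //=; split => //; exact: agree1.
Qed.

Let agreementV_fin T T' : (agreement T T')^-1%E \is a fin_num.
Proof.
have := agreement_ge1 T T'; case: inveP => //=.
by rewrite lee_fin leNgt ltr01.
Qed.

Let agreement_le T1 T2 T3 T4 :
  (forall n, (0 < n)%N -> T1 n = T2 n -> T3 n = T4 n) ->
  tree_dist T3 T4 <= tree_dist T1 T2.
Proof.
move=> H; rewrite /tree_dist -/(agreement T1 T2) -/(agreement T3 T4).
apply: fine_le => //; rewrite lee_pV2 ?inE; last 2 first.
- exact: le_trans (agreement_ge1 _ _).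
- exact: le_trans (agreement_ge1 _ _).
apply: le_ereal_sup => _ [n [n0 nE] <-]; exists n => //=; split => //.
exact: H.
Qed.

Let tree_dist_ge0 T T' : 0 <= tree_dist T T'.
Proof.
apply: fine_ge0; rewrite inve_ge0; exact: le_trans (agreement_ge1 _ _).
Qed.

Lemma tree_distxx T : tree_dist T T = 0.
Proof.
rewrite /tree_dist (_ : ereal_sup _ = +oo%E) ?invey//.
apply/eqyP => M M0; apply: ereal_sup_ge.
have [n /ltW Mn] : exists n : nat, M < n%:R.
  by exists (Num.truncn M).+1%N; exact: truncnS_gt.
exists n%:R%:E; last by rewrite lee_fin.
exists n => //=; split => //; rewrite -(@ltr_nat R); exact: lt_le_trans Mn.
Qed.

Lemma tree_dist_positivity T T' : tree_dist T T' = 0 -> T = T'.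
Proof.
rewrite /tree_dist -/(agreement T T').
move=> /eqP; rewrite fine_eq0// inve_eq0 => /eqP supoo.
apply: ktree_inj => n n0.
have : (n%:R%:E < agreement T T')%E by rewrite supoo ltry.
move=> /ereal_sup_gt[_ [m [_ mE] <-]]; rewrite lte_fin ltr_nat => nm.
exact: agree_le (ltnW nm) mE.
Qed.

Lemma tree_dist_sym T T' : tree_dist T T' = tree_dist T' T.
Proof. by apply/le_anti/andP; split; apply: agreement_le. Qed.

Lemma tree_dist_triangle T2 T1 T3 :
  tree_dist T1 T3 <= tree_dist T1 T2 + tree_dist T2 T3.
Proof.
have [H|] := pselect (forall n, (0 < n)%N -> T1 n = T2 n -> T2 n = T3 n).
  apply: (@le_trans _ _ (tree_dist T1 T2)); last by rewrite lerDl.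
  by apply: agreement_le => n n0 E; rewrite E; exact: H.
move=> /existsNP[n /not_implyP[n0 /not_implyP[E12 NE23]]].
apply: (@le_trans _ _ (tree_dist T2 T3)); last by rewrite lerDr.
apply: agreement_le => m m0 E23; rewrite -E23; apply: agree_le E12.
by rewrite leqNgt; apply/negP => /ltnW nm; apply: NE23; exact: agree_le E23.
Qed.

HB.instance Definition _ := gen_eqMixin (ktree R k2).
HB.instance Definition _ := gen_choiceMixin (ktree R k2).
HB.instance Definition _ := isPointed.Build (ktree R k2)
  (KTree R k2 (fun n => @comb_ktree k n k2) comb_compat).
HB.instance Definition _ := isMetric.Build R (ktree R k2)
  tree_distxx tree_dist_positivity tree_dist_sym tree_dist_triangle.

Definition ktree_display : measure_display. Proof. by constructor. Qed.

(* Borel $\sigma$-algebra *)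
Let ktree_measurable : set (set (ktree R k2)) := <<s open >>.

Let ktree_measurable0 : ktree_measurable set0.
Proof. exact: sigma_algebra0. Qed.

Let ktree_measurableC A : ktree_measurable A -> ktree_measurable (~` A).
Proof. exact: sigma_algebraC. Qed.

Let ktree_measurableU (F : (set (ktree R k2))^nat) :
  (forall i, ktree_measurable (F i)) -> ktree_measurable (\bigcup_i F i).
Proof. exact: sigma_algebra_bigcup. Qed.

HB.instance Definition _ := @isMeasurable.Build ktree_display (ktree R k2)
  ktree_measurable ktree_measurable0 ktree_measurableC ktree_measurableU.

End tree_metric.

(* $\mathcal{P}_{\mathrm m}^{(k)}$ with indices shifted by one:
   $s_j$ is [s j.-1]. *)
Record mass_partition (R : realType) (k : nat) (k2 : (1 < k)%N) :=
  MassPartition {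
    mass :> nat -> R ;
    mass_ge0 : forall j, 0 <= mass j ;
    mass_noninc : forall i j, (i <= j)%N -> mass j <= mass i ;
    mass_eq0 : forall j, (k <= j)%N -> mass j = 0 ;
    mass_sum1 : \sum_(j < k) mass j = 1
  }.

Section mass_partition_measurable.
Context (R : realType) (k : nat) (k2 : (1 < k)%N).

Lemma unit_mass_ge0 j : 0 <= (j == 0%N)%:R :> R.
Proof. exact: ler0n. Qed.

Lemma unit_mass_noninc i j : (i <= j)%N -> (j == 0%N)%:R <= (i == 0%N)%:R :> R.
Proof. by case: i j => [|i] [|j]//= _; rewrite ?ler01. Qed.

Lemma unit_mass_eq0 j : (k <= j)%N -> (j == 0%N)%:R = 0 :> R.
Proof. by case: j => //; rewrite leqNgt (ltnW k2). Qed.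

Lemma unit_mass_sum1 : \sum_(j < k) ((j : nat) == 0%N)%:R = 1 :> R.
Proof.
rewrite (bigD1 (Ordinal (ltnW k2)))//= big1 ?addr0// => i.
by rewrite -val_eqE /= => /negbTE ->.
Qed.

(* (1,0,0,...) *)
Definition unit_mass : mass_partition R k2 :=
  MassPartition k2 unit_mass_ge0 unit_mass_noninc unit_mass_eq0 unit_mass_sum1.

HB.instance Definition _ := gen_eqMixin (mass_partition R k2).
HB.instance Definition _ := gen_choiceMixin (mass_partition R k2).
HB.instance Definition _ := isPointed.Build (mass_partition R k2) unit_mass.

Definition mass_partition_display : measure_display.
Proof. by constructor. Qed.

(* The $\sigma$-algebra generated by the coordinates. *)
Let mp_measurable : set (set (mass_partition R k2)) :=
  <<s [set A | exists j (B : set R),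
         measurable B /\ A = [set s : mass_partition R k2 | B (s j)]] >>.

Let mp_measurable0 : mp_measurable set0.
Proof. exact: sigma_algebra0. Qed.

Let mp_measurableC A : mp_measurable A -> mp_measurable (~` A).
Proof. exact: sigma_algebraC. Qed.

Let mp_measurableU (F : (set (mass_partition R k2))^nat) :
  (forall i, mp_measurable (F i)) -> mp_measurable (\bigcup_i F i).
Proof. exact: sigma_algebra_bigcup. Qed.

HB.instance Definition _ := @isMeasurable.Build mass_partition_display
  (mass_partition R k2) mp_measurable mp_measurable0 mp_measurableC
  mp_measurableU.

End mass_partition_measurable.

Section rates.
Context (R : realType) (k : nat) (k2 : (1 < k)%N).
Variable nu : probability (mass_partition R k2) R.

(* The partition of [c] with i ~ j iff X_i = X_j. *)
Definition color_partition (c : {fset nat}) (X : {ffun c -> 'I_k}) :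
    {fset {fset nat}} :=
  [fset [fset val j | j : c & X j == X i] | i : c]%fset.

(* Law of the restriction to [c] of the paintbox partition: the colours
   $(X_i)_{i\in c}$ equal a given map with probability $\prod_i s_{X_i}$. *)
Definition paintbox (s : mass_partition R k2) (c : {fset nat})
    (sigma : {fset {fset nat}}) : R :=
  \sum_(X : {ffun c -> 'I_k} | color_partition X == sigma)
     \prod_(i : c) s (X i).

Definition mixed_paintbox (c : {fset nat}) (sigma : {fset {fset nat}}) : R :=
  \int[nu]_s paintbox s c sigma.

(* $p_b(\pi,\pi';\nu)$ *)
Definition cp_prob (pi pi' : {fset {fset nat}}) : R :=
  k`!%:R / (k - #|` pi'|)`!%:R *
  \prod_(c <- pi)
    ((k - #|` restrict_sets pi' c|)`!%:R / k`!%:R *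
     mixed_paintbox c (restrict_sets pi' c)).

(* $Q_n(T,T';\nu)$ *)
Definition tree_kernel (T T' : {fset {fset nat}}) : R :=
  \prod_(b <- T' | (1 < #|` b|)%N)
    (cp_prob (root_partition T b) (root_partition T' b) /
     (1 - cp_prob (root_partition T b) [fset b]%fset)).

End rates.

Section markov.
Context (R : realType) d (Omega : measurableType d).

(* Natural filtration at time [s] of an [E]-valued process, [M] being the
   $\sigma$-algebra of [E]. *)
Definition history (E : Type) (M : set (set E)) (Y : R -> Omega -> E) (s : R) :
    set (set Omega) :=
  <<s [set F | exists u B, [/\ 0 <= u <= s, M B & F = Y u @^-1` B]] >>.

(* [p t x y] is the transition function of a continuous-time Markov chain on
   the finite set [S], with jump rate [q x y] from [x] to [y] for [x != y]. *)
Record transition_function (E : choiceType) (S : {fset E}) (q : E -> E -> R)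
    (p : R -> E -> E -> R) : Prop := {
  transition_ge0 : forall t x y, 0 <= t -> x \in S -> y \in S -> 0 <= p t x y ;
  transition_sum1 : forall t x, 0 <= t -> x \in S -> \sum_(y <- S) p t x y = 1 ;
  transition_at0 : forall x y, x \in S -> y \in S -> p 0 x y = (x == y)%:R ;
  chapman_kolmogorov : forall s t x y, 0 <= s -> 0 <= t ->
    x \in S -> y \in S -> p (s + t) x y = \sum_(z <- S) p s x z * p t z y ;
  jump_rate : forall x y, x \in S -> y \in S -> x != y ->
    p h x y / h @[h --> 0^'+] --> q x y
}.

Record markov_jump_process (E : choiceType) (S : {fset E}) (q : E -> E -> R)
    (P : probability Omega R) (Y : R -> Omega -> E) : Prop := {
  jump_process_in : forall (t : R) w, 0 <= t -> Y t w \in S ;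
  jump_process_measurable : forall (t : R) x, 0 <= t ->
    measurable (Y t @^-1` [set x]) ;
  jump_process_markov : exists2 p, transition_function S q p &
    forall (s t : R) F x y, 0 <= s -> 0 <= t -> history setT Y s F ->
      x \in S -> y \in S ->
      P (F `&` Y s @^-1` [set x] `&` Y (s + t) @^-1` [set y]) =
      (P (F `&` Y s @^-1` [set x]) * (p t x y)%:E)%E
}.

(* Time-homogeneous Markov process on [E], [P x] being the law under which it
   starts from [x]; the Markov property is the integrated form of
   $P_x(Y_{s+t}\in A\mid\mathcal F_s)=P_{Y_s}(Y_t\in A)$ a.s. *)
Record markov_process d' (E : measurableType d') (P : E -> probability Omega R)
    (Y : R -> Omega -> E) : Prop := {
  process_measurable : forall t : R, 0 <= t -> measurable_fun setT (Y t) ;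
  process_start : forall x, P x (Y 0 @^-1` [set x]) = 1%E ;
  process_kernel : forall (t : R) A, 0 <= t -> measurable A ->
    measurable_fun setT (fun x => P x (Y t @^-1` A)) ;
  process_markov : forall x (s t : R) F A, 0 <= s -> 0 <= t ->
    history measurable Y s F -> measurable A ->
    P x (F `&` Y (s + t) @^-1` A) =
    (\int[P x]_(w in F) P (Y s w) (Y t @^-1` A))%E
}.

(* $\mathbb{P}_t\varphi(x)=\mathbb{E}_x\varphi(Y_t)$ *)
Definition semigroup (E : Type) (P : E -> probability Omega R)
    (Y : R -> Omega -> E) (t : R) (phi : E -> R) (x : E) : R :=
  fine 'E_(P x)[phi \o Y t].

Definition CP_ancestral_branching (k : nat) (k2 : (1 < k)%N) (lambda : R)
    (nu : probability (mass_partition R k2) R)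
    (P : ktree R k2 -> probability Omega R) (X : R -> Omega -> ktree R k2) :
    Prop :=
  markov_process P X /\
  forall tau n, (0 < n)%N ->
    markov_jump_process (ktrees k n) (fun T T' => lambda * tree_kernel nu T T')
      (P tau) (fun t w => X t w n).

End markov.

(* Main.v *)
(** The space of trees is compact and two trees are close iff they agree up to a
    large [n], so a continuous [phi] is uniformly approximated by functions
    [psi] of the restriction to [[n]].  Up to a uniform error, [P_t phi tau] is
    therefore [\sum_y psi y * p_t(tau n, y)], where [p] is the transition
    function of the chain of restrictions.  This tends to [psi (tau n)] as
    [t] tends to 0 because [p] is stochastic with finite rates.  It depends on
    [tau] only through [tau n], because a transition function on a finite set is
    determined by its rates: if [p_h - p'_h = o(h)], then telescoping
    [p_t = (p_(t/m))^m] and contractivity of stochastic matrices give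
    [|p_t - p'_t| <= m * o(t/m)], which tends to 0. *)

Require Import Defs.
From mathcomp Require Import all_boot all_order all_algebra finmap.
From mathcomp Require Import all_classical all_reals all_analysis.
From mathcomp Require Import measurable_realfun.
From mathcomp Require Import ring.

Import Order.TTheory GRing.Theory Num.Theory.
Import numFieldNormedType.Exports.

Local Open Scope classical_set_scope.
Local Open Scope ring_scope.

(** * Transition functions on a finite set *)

(** The difference at time [(m+1)h] is [p_h (p_mh - p'_mh) + (p_h - p'_h) p'_mh]. The rows of [p_h]
    and [p'_mh] are probability vectors, so each step adds at most [e]. *)
Lemma transition_l1_dist (R : realType) (E : choiceType) (S : {fset E})
    (q q' : E -> E -> R) (p p' : R -> E -> E -> R) (h e : R) :
  transition_function S q p -> transition_function S q' p' -> 0 <= h ->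
  (forall x, x \in S -> \sum_(y <- S) `|p h x y - p' h x y| <= e) ->
  forall (m : nat) x, x \in S ->
    \sum_(y <- S) `|p (h *+ m) x y - p' (h *+ m) x y| <= e *+ m.
Proof.
move=> pP p'P h0 he; elim=> [|m IH] x xS.
  rewrite !mulr0n big_seq big1// => y yS.
  by rewrite (transition_at0 pP)// (transition_at0 p'P)// subrr normr0.
have mh0 : 0 <= h *+ m by rewrite mulrn_wge0.
pose a z := p h x z; pose d z := p h x z - p' h x z.
have step y : y \in S -> `|p (h *+ m.+1) x y - p' (h *+ m.+1) x y| <=
    \sum_(z <- S) (a z * `|p (h *+ m) z y - p' (h *+ m) z y|
                   + `|d z| * p' (h *+ m) z y).
  move=> yS; rewrite mulrS (chapman_kolmogorov pP)// (chapman_kolmogorov p'P)//.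
  rewrite -sumrB; apply: le_trans (ler_norm_sum _ _ _) _.
  rewrite [leLHS]big_seq [leRHS]big_seq; apply: ler_sum => z zS.
  rewrite (_ : _ - _ = a z * (p (h *+ m) z y - p' (h *+ m) z y)
                       + d z * p' (h *+ m) z y); last first.
    by rewrite /a /d mulrBr mulrBl addrA subrK.
  apply: le_trans (ler_normD _ _) _.
  rewrite !normrM (ger0_norm (transition_ge0 pP h0 xS zS)).
  by rewrite (ger0_norm (transition_ge0 p'P mh0 zS yS)).
apply: (@le_trans _ _ (\sum_(z <- S) (a z * (e *+ m) + `|d z|))); last first.
  rewrite big_split/= -mulr_suml (transition_sum1 pP)// mul1r mulrS addrC.
  by rewrite lerD2r he.
rewrite big_seq; apply: le_trans (ler_sum _ step) _.
rewrite -big_seq exchange_big/= [leLHS]big_seq [leRHS]big_seq.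
apply: ler_sum => z zS; rewrite big_split/= -!mulr_sumr.
rewrite (transition_sum1 p'P)// mulr1 lerD2r ler_wpM2l ?IH//.
exact: transition_ge0 pP _ _ _ h0 xS zS.
Qed.

(* Equal off-diagonal rates force the rows of [p] and [p'] to differ by o(h),
   the diagonal entries being determined by the others. *)
Lemma transition_l1_dist_rate (R : realType) (E : choiceType) (S : {fset E})
    (q : E -> E -> R) (p p' : R -> E -> E -> R) (x : E) :
  transition_function S q p -> transition_function S q p' -> x \in S ->
  (\sum_(y <- S) `|p h x y - p' h x y|) / h @[h --> 0^'+] --> (0 : R).
Proof.
move=> pP p'P xS.
have offdiag y : y \in S -> y != x ->
    (p h x y - p' h x y) / h @[h --> 0^'+] --> (0 : R).
  move=> yS yx; rewrite -[X in _ --> X](subrr (q x y)).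
  under eq_fun do rewrite mulrBl.
  rewrite eq_sym in yx.
  exact: cvgB (jump_rate pP xS yS yx) (jump_rate p'P xS yS yx).
(* Both rows sum to 1, so the diagonal difference is at most the sum of the off-diagonal ones; hence
   the factor 2. *)
have tot : \sum_(y <- S | y != x) 2 * `|(p h x y - p' h x y) / h| @[h --> 0^'+]
    --> (0 : R).
  rewrite [X in _ --> X](_ : 0 = \sum_(y <- S | (y \in S) && (y != x)) 0);
    last by rewrite big1.
  under eq_fun do rewrite big_seq_cond.
  apply: cvg_big; first exact: add_continuous.
  move=> y /andP[yS yx]; have := cvg_norm (offdiag y yS yx).
  rewrite normr0 => H; rewrite -[X in _ --> X](mulr0 2).
  by apply: cvgM; [exact: cvg_cst|exact: H].
apply: squeeze_cvgr tot; last exact: cvg_cst.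
near=> h; have h0 : 0 < h by near: h; exact: nbhs_right_gt.
rewrite divr_ge0 ?sumr_ge0 ?(ltW h0)//=.
rewrite -mulr_sumr
  [X in _ <= 2 * X](eq_bigr (fun y => `|p h x y - p' h x y| / h)); last first.
  by move=> y _; rewrite normrM normfV (gtr0_norm h0).
rewrite -mulr_suml mulrA ler_pM2r ?invr_gt0//.
rewrite (big_rem x)//= rem_filter ?fset_uniq// big_filter/=.
rewrite mulrDl mul1r lerD2r.
have sum0 : \sum_(y <- S) (p h x y - p' h x y) = 0.
  by rewrite sumrB (transition_sum1 pP) ?(transition_sum1 p'P) ?ltW// subrr.
move: sum0; rewrite (big_rem x)//= rem_filter ?fset_uniq// big_filter/=.
by move=> /eqP; rewrite addr_eq0 => /eqP ->; rewrite normrN ler_norm_sum.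
Unshelve. all: by end_near. Qed.

Lemma transition_function_unique (R : realType) (E : choiceType) (S : {fset E})
    (q : E -> E -> R) (p p' : R -> E -> E -> R) (t : R) (x y : E) :
  transition_function S q p -> transition_function S q p' ->
  0 <= t -> x \in S -> y \in S -> p t x y = p' t x y.
Proof.
move=> pP p'P t0 xS yS; have [->|tN0] := eqVneq t 0.
  by rewrite (transition_at0 pP)// (transition_at0 p'P).
have {tN0 t0} t0 : 0 < t by rewrite lt_neqAle eq_sym tN0.
apply/eqP; rewrite -subr_eq0 -normr_le0; apply/ler_addgt0Pl => e e0.
rewrite addr0.
(* An error [e / n] per step of length [t / n] accumulates to [e] at time [t]. *)
have /= [n [n0 hn]] : exists n : nat, (0 < n)%N /\ forall z, z \in S ->
    \sum_(y <- S) `|p (t / n%:R) z y - p' (t / n%:R) z y| <= e / n%:R.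
  have rate : \forall h \near 0^'+, forall z, z \in S ->
      (\sum_(y <- S) `|p h z y - p' h z y|) / h <= e / t.
    (* Summing over the finitely many starting points makes the o(h) bound uniform in [z]. *)
    have tot : (\sum_(z <- S) (\sum_(y <- S) `|p h z y - p' h z y|) / h)
        @[h --> 0^'+] --> (0 : R).
      rewrite [X in _ --> X](_ : 0 = \sum_(z <- S | z \in S) 0);
        last by rewrite big1.
      under eq_fun do rewrite big_seq.
      apply: cvg_big; first exact: add_continuous.
      by move=> z zS; exact: (transition_l1_dist_rate _ _ _ _ _ _ _ pP p'P zS).
    have et : 0 < e / t by rewrite divr_gt0.
    near=> h => z zS.
    have h0 : 0 < h by near: h; exact: nbhs_right_gt.
    have : \sum_(z <- S) (\sum_(y <- S) `|p h z y - p' h z y|) / h <= e / t.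
      near: h; move/cvgr_le : tot; exact.
    apply: le_trans; rewrite [leRHS](big_rem z)//= lerDl sumr_ge0// => i _.
    by rewrite divr_ge0 ?sumr_ge0 ?(ltW h0).
  have [d /= d0 dP] := rate.
  (* The rate bound holds for [0 < h < d], and [n > t / d] puts [t / n] in this range. *)
  have [n nd] : exists n : nat, t / d < n%:R.
    by exists (Num.truncn (t / d)).+1; exact: truncnS_gt.
  have n0 : (0 < n)%N.
    by rewrite -(@ltr_nat R); apply: le_lt_trans nd; rewrite divr_ge0 ?ltW.
  have n0' : 0 < n%:R :> R by rewrite ltr0n.
  exists n; split=> // z zS.
  have tn0 : 0 < t / n%:R by rewrite divr_gt0.
  have := dP (t / n%:R); rewrite /= sub0r normrN (gtr0_norm tn0).
  rewrite ltr_pdivrMr// mulrC -ltr_pdivrMr// => /(_ nd tn0 z zS).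
  rewrite ler_pdivrMr// => /le_trans; apply.
  by rewrite mulrA divfK// gt_eqF.
have n0' : n%:R != 0 :> R by rewrite pnatr_eq0 -lt0n.
have := @transition_l1_dist _ _ _ _ _ _ _ _ _ pP p'P _ hn n x xS.
rewrite -[t / _ *+ n]mulr_natr -[e / _ *+ n]mulr_natr !divfK//.
move=> /(_ (divr_ge0 (ltW t0) (ler0n _ _))); apply: le_trans.
by rewrite (big_rem y)//= lerDl sumr_ge0.
Unshelve. all: by end_near. Qed.

(** Continuity at 0 comes from the rates: for [y != x], [p h x y] is the product of [p h x y / h],
    which tends to [q x y], and [h]. The row sum 1 then settles the diagonal term. *)
Lemma transition_cvg0 (R : realType) (E : choiceType) (S : {fset E})
    (q : E -> E -> R) (p : R -> E -> E -> R) (x : E) (f : E -> R) :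
  transition_function S q p -> x \in S ->
  \sum_(y <- S) f y * p h x y @[h --> 0^'+] --> f x.
Proof.
move=> pP xS.
have split_x h : 0 < h -> \sum_(y <- S) f y * p h x y =
    f x + \sum_(y <- S | y != x) (f y - f x) * p h x y.
  move=> h0; have /eqP := transition_sum1 pP (ltW h0) xS.
  rewrite (big_rem x)//= rem_filter ?fset_uniq// big_filter/= => /eqP px.
  rewrite (big_rem x)//= rem_filter ?fset_uniq// big_filter/=.
  rewrite -{2}[f x]mulr1 -px mulrDr -addrA; congr (_ + _).
  rewrite mulr_sumr -big_split/=; apply: eq_bigr => y _.
  by rewrite mulrBl addrC subrK.
have tot : \sum_(y <- S | y != x) (f y - f x) * p h x y @[h --> 0^'+]
    --> (0 : R).
  rewrite [X in _ --> X](_ : 0 = \sum_(y <- S | (y \in S) && (y != x)) 0);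
    last by rewrite big1.
  under eq_fun do rewrite big_seq_cond.
  apply: cvg_big; first exact: add_continuous.
  move=> y /andP[yS yx]; rewrite -[X in _ --> X](mulr0 (f y - f x)).
  apply: cvgM; first exact: cvg_cst.
  rewrite eq_sym in yx; have pq := jump_rate pP xS yS yx.
  have id0 : (h : R) @[h --> 0^'+] --> (0 : R).
    by apply: cvg_at_right_filter => A.
  have pq0 : p h x y / h * h @[h --> 0^'+] --> q x y * 0 := cvgM pq id0.
  rewrite mulr0 in pq0.
  have /near_eq_cvg eqp : {near 0^'+, (fun h => p h x y / h * h)
      =1 (fun h => p h x y)}.
    near=> h; have h0 : 0 < h by near: h; exact: nbhs_right_gt.
    by rewrite /= divfK// gt_eqF.
  by move=> A /pq0; exact: eqp.
have /near_eq_cvg eqf : {near 0^'+,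
    (fun h => f x + \sum_(y <- S | y != x) (f y - f x) * p h x y)
    =1 (fun h => \sum_(y <- S) f y * p h x y)}.
  near=> h; have h0 : 0 < h by near: h; exact: nbhs_right_gt.
  by rewrite /= split_x.
rewrite -[X in _ --> X]addr0.
by move=> A /(cvgD (cvg_cst (f x)) tot); exact: eqf.
Unshelve. all: by end_near. Qed.

(** * Topology of the space of trees *)

Lemma tree_dist_le_inv (R : realType) (k : nat) (k2 : (1 < k)%N)
    (T T' : ktree R k2) (n : nat) :
  (0 < n)%N -> T n = T' n -> tree_dist T T' <= n%:R^-1.
Proof.
move=> n0 TT'; rewrite /tree_dist; set s := ereal_sup _.
have ns : (n%:R%:E <= s)%E.
  by apply: ereal_sup_ubound; exists n.
have n0' : 0 < n%:R :> R by rewrite ltr0n.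
case: s ns => [r| |]//; last by rewrite invey invr_ge0 ler0n.
rewrite lee_fin => nr; have r0 := lt_le_trans n0' nr.
by rewrite inver gt_eqF//= lef_pV2// posrE.
Qed.

Lemma tree_dist_lt_inv (R : realType) (k : nat) (k2 : (1 < k)%N)
    (T T' : ktree R k2) (n : nat) :
  (0 < n)%N -> tree_dist T T' < n%:R^-1 -> T n = T' n.
Proof.
move=> n0; have := agreement_ge1 T T'.
rewrite /tree_dist; set s := ereal_sup _ => s1 sn.
have n0' : 0 < n%:R :> R by rewrite ltr0n.
have /ereal_sup_gt[_ [m [_ mE] <-]] : (n%:R%:E < s)%E.
  case: s s1 sn => [r| |]//; last by rewrite ltry.
  rewrite lee_fin lte_fin => r1; have r0 := lt_le_trans ltr01 r1.
  by rewrite inver gt_eqF//= ltf_pV2// posrE.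
by rewrite lte_fin ltr_nat => /ltnW nm; exact: agree_le nm mE.
Qed.

Lemma nbhs_ktreeP (R : realType) (k : nat) (k2 : (1 < k)%N) (T : ktree R k2)
    (A : set (ktree R k2)) :
  nbhs T A <-> exists n, [set T' : ktree R k2 | T n = T' n] `<=` A.
Proof.
split=> [/nbhs_ballP[e /= e0 eA]|[n nA]].
  exists (Num.truncn e^-1).+1 => T' /= TT'; apply: eA.
  have h := tree_dist_le_inv _ _ _ _ _ _ (ltn0Sn _) TT'.
  apply: le_lt_trans h _.
  by rewrite -[ltRHS]invrK ltf_pV2 ?posrE ?invr_gt0// truncnS_gt.
(* The level [n.+1] is positive even if [n] is 0, and agreement there passes down to [n]. *)
apply/nbhs_ballP; exists n.+1%:R^-1 => /=; first by rewrite invr_gt0.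
move=> T' h; apply: nA; apply: agree_le (leqnSn n) _.
exact: tree_dist_lt_inv h.
Qed.

Lemma ktree_at_in (R : realType) (k : nat) (k2 : (1 < k)%N) (T : ktree R k2)
    (n : nat) : (0 < n)%N -> T n \in ktrees k n.
Proof.
move=> n0; have Tn := tree_atP T n0.
rewrite /ktrees !inE Tn andbT fpowersetE; apply/fsubsetP => t tT.
have /andP[/and4P[_ /allP/(_ _ tT)/andP[_ tn] _ _] _] := Tn.
by rewrite fpowersetE.
Qed.

(** Otherwise the complements of the finitely many fibres over [ktrees k n.+1] all belong to [F],
    and so does their intersection, which is empty. Level [n.+1] covers the case [n = 0]. *)
Lemma ultra_ktree_at (R : realType) (k : nat) (k2 : (1 < k)%N)
    (F : set_system (ktree R k2)) (n : nat) : UltraFilter F ->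
  exists T : ktree R k2, F [set T' : ktree R k2 | T n = T' n].
Proof.
move=> FU; apply: contrapT => /forallNP noT.
have FS : F [set T' : ktree R k2 | T' n.+1 \notin ktrees k n.+1].
  have : F (\bigcap_(y in [set` ktrees k n.+1])
             ~` [set T' : ktree R k2 | T' n.+1 = y]).
    apply: filter_bigI => y _.
    have [Fy|//] := in_ultra_setVsetC [set T' : ktree R k2 | T' n.+1 = y] FU.
    have [T Ty] := filter_ex Fy; exfalso; apply: (noT T).
    apply: filterS Fy => T' /= T'y; apply: agree_le (leqnSn n) _.
    by rewrite Ty T'y.
  apply: filterS => T' H; apply/negP => T'S.
  exact: (H _ T'S).
by have [T /=] := filter_ex FS; rewrite ktree_at_in.
Qed.

(** The cylinders selected by an ultrafilter at two levels intersect, so the selected finite trees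
    are compatible; they assemble diagonally into a tree to which the ultrafilter converges. *)
Lemma ktree_compact (R : realType) (k : nat) (k2 : (1 < k)%N) :
  compact [set: ktree R k2].
Proof.
rewrite compact_ultra => F FU _.
have /choice[c cF] := fun n => ultra_ktree_at _ _ _ F n FU.
have compat m n : (m <= n)%N ->
    restrict_sets (c n n) (interval_fset m) = c m m.
  move=> mn; have [T [/= -> ->]] := filter_ex (filterI (cF m) (cF n)).
  exact: tree_at_compat.
pose T := KTree R k2 (fun n n0 => tree_atP (c n) n0) compat.
exists T; split=> // A /nbhs_ktreeP[n nA].
by apply: filterS (cF n) => T' TT'; exact: nA.
Qed.

Lemma ktree_uniform_continuity (R : realType) (k : nat) (k2 : (1 < k)%N)
    (phi : ktree R k2 -> R) (e : R) : continuous phi -> 0 < e ->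
  exists2 n, (0 < n)%N &
    forall T T' : ktree R k2, T n = T' n -> `|phi T - phi T'| <= e.
Proof.
move=> cphi e0.
have /compact_near_coveringP cov := ktree_compact R k k2.
have [n _ nP] : \forall n \near \oo, [set: ktree R k2] `<=`
    [set T : ktree R k2 |
       forall T' : ktree R k2, T n = T' n -> `|phi T - phi T'| <= e].
  apply: cov => T _; have e2 : 0 < e / 2 by rewrite divr_gt0.
  have /cvgrPdist_le/(_ _ e2)/nbhs_ktreeP[N NP] := cphi T.
  (* If [T1] is in the level [N] cylinder of [T], so is every tree agreeing with [T1] up to a level
     [n >= N]; both values of [phi] are then within [e / 2] of [phi T]. *)
  exists ([set T' : ktree R k2 | T N = T' N], [set n | (N <= n)%N]) => /=.
    by split; [apply/nbhs_ktreeP; exists N|exists N].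
  move=> [T1 n] /= [TN nN] T2 T12.
  have h1 := NP T1 TN.
  have h2 : `|phi T - phi T2| <= e / 2.
    by apply: NP => /=; rewrite TN; exact: agree_le nN T12.
  rewrite (_ : phi T1 - phi T2 = (phi T - phi T2) - (phi T - phi T1)).
    by apply: le_trans (ler_normB _ _) _; rewrite [e]splitr lerD.
  by rewrite opprB [RHS]addrC subrKA.
by exists n.+1 => // T T'; apply: nP => //=.
Qed.

Lemma ktree_continuous_bounded (R : realType) (k : nat) (k2 : (1 < k)%N)
    (phi : ktree R k2 -> R) : continuous phi -> [bounded phi T | T in setT].
Proof.
move=> cphi.
have /compact_bounded[M [Mr HM]] :=
  continuous_compact (continuous_subspaceT cphi) (ktree_compact R k k2).
by exists M; split=> // r Mr' T _; apply: HM => //; exists T.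
Qed.

Lemma ktree_continuous_measurable (R : realType) (k : nat) (k2 : (1 < k)%N)
    (phi : ktree R k2 -> R) : continuous phi -> measurable_fun setT phi.
Proof.
move=> /continuousP cphi; apply: (measurability _ (RGenOpens.measurableE R)).
move=> _ [_ [a [b ->] <-]]; rewrite setTI.
apply: sub_sigma_algebra; apply: cphi; exact: interval_open.
Qed.

(** * Expectations of functions of a finite restriction *)

(** Integrability and value share one induction, since additivity of the integral uses integrability
    of the tail. *)
Lemma Rintegral_sum_indic (d : measure_display) (Omega : measurableType d)
    (R : realType) (Q : probability Omega R) (I : Type) (s : seq I)
    (c : I -> R) (A : I -> set Omega) : (forall i, measurable (A i)) ->
  Q.-integrable setT (EFin \o (fun w => \sum_(i <- s) c i * \1_(A i) w)) /\
  \int[Q]_w (\sum_(i <- s) c i * \1_(A i) w) =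
    \sum_(i <- s) c i * fine (Q (A i)).
Proof.
move=> mA; elim: s => [|i s [IHi IHE]].
  have -> : (fun w => \sum_(i <- [::]) c i * \1_(A i) w) = cst 0.
    by apply/funext => w; rewrite big_nil.
  split; first exact: finite_measure_integrable_cst.
  by rewrite Rintegral_cst// mul0r big_nil.
have -> : (fun w => \sum_(j <- i :: s) c j * \1_(A j) w) =
    (fun w => c i * \1_(A i) w + \sum_(j <- s) c j * \1_(A j) w).
  by apply/funext => w; rewrite big_cons.
have iA := integrable_indic Q (mA i).
have icA : Q.-integrable setT (EFin \o (fun w => c i * \1_(A i) w)).
  rewrite (_ : _ \o _ = fun w => ((c i)%:E * (\1_(A i) w)%:E)%E)//.
  exact: integrableZl.
split; first exact: integrableD icA IHi.
rewrite RintegralD// IHE big_cons RintegralZl//.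
by rewrite /Rintegral integral_indic// setIT.
Qed.

Lemma normr_Rintegral_sub_le (d : measure_display) (Omega : measurableType d)
    (R : realType) (Q : probability Omega R) (f g : Omega -> R) (e : R) :
  Q.-integrable setT (EFin \o f) -> Q.-integrable setT (EFin \o g) ->
  (forall w, `|f w - g w| <= e) ->
  `|\int[Q]_w f w - \int[Q]_w g w| <= e.
Proof.
move=> fi gi fge; rewrite -RintegralB//.
have ifg : Q.-integrable setT (EFin \o (f \- g)).
  exact: integrableB fi gi.
apply: le_trans (le_normr_Rintegral _ ifg) _ => //.
have <- : \int[Q]_w e = e.
  by rewrite Rintegral_cst//= [Q _]probability_setT mulr1.
apply: le_Rintegral => //=; first exact: integrable_norm ifg.
exact: finite_measure_integrable_cst.
Qed.

Lemma jump_process_law (R : realType) (d : measure_display)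
    (Omega : measurableType d) (E : choiceType) (S : {fset E})
    (q : E -> E -> R) (Q : probability Omega R) (Y : R -> Omega -> E)
    (x0 : E) : x0 \in S -> markov_jump_process S q Q Y ->
  Q (Y 0 @^-1` [set x0]) = 1%E ->
  exists2 p, transition_function S q p &
    forall t y, 0 <= t -> y \in S -> fine (Q (Y t @^-1` [set y])) = p t x0 y.
Proof.
move=> x0S YP Y0; have [p pP markov] := jump_process_markov YP.
exists p => // t y t0 yS.
have mY s z : 0 <= s -> measurable (Y s @^-1` [set z]).
  by move=> s0; exact: jump_process_measurable YP _ _ s0.
have hT : history setT Y 0 setT.
  rewrite -(setD0 [set: Omega]); apply: sigma_algebraCD.
  exact: sigma_algebra0.
have := markov 0 t setT x0 y (lexx _) t0 hT x0S yS.
rewrite setTI add0r Y0 mul1e => pE.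
rewrite -[RHS]/(fine (p t x0 y)%:E) -pE; congr fine.
have mYt := mY _ y t0; have mY0 := mY _ x0 (lexx 0).
rewrite [LHS](measureDI _ mYt mY0) setIC [X in (X + _)%E](_ : _ = 0%E) ?add0e//.
apply: (@subset_measure0 _ _ _ Q _ (~` (Y 0 @^-1` [set x0]))).
- exact: measurableD.
- exact: measurableC.
- by move=> w [].
by have := @probability_setC _ _ _ Q _ mY0; rewrite Y0 subee.
Qed.

(** The sum is the expectation of [psi (X t w n)], written as a combination of indicators, and
    [phi (X t w)] stays within [e] of this variable. *)
Lemma semigroup_approx (R : realType) (k : nat) (k2 : (1 < k)%N)
    (d : measure_display) (Omega : measurableType d)
    (P : ktree R k2 -> probability Omega R) (X : R -> Omega -> ktree R k2)
    (phi : ktree R k2 -> R) (psi : {fset {fset nat}} -> R) (n : nat)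
    (e t : R) (tau : ktree R k2) :
  continuous phi -> measurable_fun setT (X t) ->
  (forall y, measurable ((fun w => X t w n) @^-1` [set y])) -> (0 < n)%N ->
  (forall T : ktree R k2, `|phi T - psi (T n)| <= e) ->
  `|semigroup P X t phi tau - \sum_(y <- ktrees k n)
      psi y * fine (P tau ((fun w => X t w n) @^-1` [set y]))| <= e.
Proof.
move=> cphi mX mXn n0 phiE.
have [gi <-] := Rintegral_sum_indic _ _ _ (P tau) _ (ktrees k n) psi _ mXn.
rewrite /semigroup unlock; apply: normr_Rintegral_sub_le => //.
  apply: measurable_bounded_integrable => //.
  - by apply: le_lt_trans (probability_le1 _ measurableT) _; exact: ltry.
  - by apply: measurableT_comp mX; exact: ktree_continuous_measurable.
  - have [M [Mr HM]] := ktree_continuous_bounded _ _ _ _ cphi.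
    by exists M; split=> // r Mr' w _; exact: HM.
move=> w; rewrite (big_rem (X t w n)) ?ktree_at_in//= big1_seq ?addr0.
  by rewrite indicE mem_set//= mulr1.
move=> y; rewrite rem_filter ?fset_uniq// mem_filter => /andP[_ /andP[/= yX _]].
by rewrite indicE memNset ?mulr0//=; apply/eqP; rewrite eq_sym.
Qed.

(** * The Feller property from finite restrictions *)

Theorem corollary5p13 (R : realType) (k : nat) (k2 : (2 <= k)%N)
    (lambda : R) (lambda_gt0 : 0 < lambda)
    (nu : probability (mass_partition R k2) R)
    (nu_nondegenerate : (nu [set unit_mass R k2] < 1)%E)
    (d : measure_display) (Omega : measurableType d)
    (P : ktree R k2 -> probability Omega R) (X : R -> Omega -> ktree R k2)
    (X_CP : CP_ancestral_branching lambda nu P X)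
    (phi : ktree R k2 -> R) (phi_cont : continuous phi) :
  (forall tau : ktree R k2,
     semigroup P X t phi tau @[t --> 0^'+] --> phi tau) /\
  (forall t : R, 0 < t -> continuous (semigroup P X t phi)).
Proof.
case: X_CP => -[mX X0 _ _] XP.
(* Each law [P tau] comes with its own [p], which may a priori depend on all of [tau]; uniqueness
   removes this dependence in (ii). *)
have law n : (0 < n)%N -> forall tau, exists2 p,
    transition_function (ktrees k n)
      (fun T T' => lambda * tree_kernel nu T T') p &
    forall t y, 0 <= t -> y \in ktrees k n ->
      fine (P tau ((fun w => X t w n) @^-1` [set y])) = p t (tau n) y.
  move=> n0 tau; apply: jump_process_law (XP tau n n0) _.
    exact: ktree_at_in.
  have mX0 : measurable ((fun w => X 0 w n) @^-1` [set tau n]).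
    exact: jump_process_measurable (XP tau n n0) _ _ (lexx 0).
  apply/eqP; rewrite eq_le probability_le1//= -(X0 tau).
  apply: le_measure; rewrite ?inE//; last by move=> w /= ->.
  rewrite -[X in measurable X]setTI; apply: mX => //.
  (* A singleton is Borel as a countable intersection of open cylinders. *)
  rewrite (_ : [set tau] = \bigcap_n [set T : ktree R k2 | T n = tau n]).
    apply: bigcapT_measurable => m; apply: sub_sigma_algebra.
    rewrite /= openE => T /= Tm; apply/nbhs_ktreeP; exists m => T' /= <-.
    exact: Tm.
  apply/seteqP; split=> [T /= -> //|T Ttau].
  by apply: ktree_inj => m _; exact: Ttau.
(* [n] and [psi] are chosen before [t] and [tau], so the error is uniform in both. *)
have approx e : 0 < e -> exists n (psi : {fset {fset nat}} -> R), [/\ (0 < n)%N,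
    forall T : ktree R k2, `|phi T - psi (T n)| <= e &
    forall t tau, 0 <= t -> `|semigroup P X t phi tau - \sum_(y <- ktrees k n)
      psi y * fine (P tau ((fun w => X t w n) @^-1` [set y]))| <= e].
  move=> e0; have [n n0 phin] := ktree_uniform_continuity _ _ _ _ _ phi_cont e0.
  (* [psi y] is the value of [phi] at some tree restricting to [y]. The default [point] occurs only
     if there is none, hence never for [y = T n]. *)
  pose psi y := phi (xget point [set T : ktree R k2 | T n = y]).
  have phipsi (T : ktree R k2) : `|phi T - psi (T n)| <= e.
    apply: phin; rewrite /psi; case: xgetP => [T' _ /= ->//|/(_ T)].
    by move=> /(_ erefl).
  exists n, psi; split=> // t tau t0.
  apply: semigroup_approx => //; first exact: mX.
  by move=> y; exact: jump_process_measurable (XP tau n n0) _ _ t0.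
split=> [tau|t t0 tau].
  apply/cvgrPdist_le => e e0; have e3 : 0 < e / 3 by rewrite divr_gt0.
  have [n [psi [n0 phipsi sem]]] := approx _ e3.
  have [p pP pE] := law n n0 tau.
  have := transition_cvg0 _ _ _ _ _ _ psi pP (ktree_at_in _ _ _ tau n n0).
  move=> /cvgrPdist_le/(_ _ e3) psicvg.
  near=> h; have h0 : 0 < h by near: h; exact: nbhs_right_gt.
  have := sem h tau (ltW h0); rewrite distrC.
  rewrite (eq_big_seq (fun y => psi y * p h (tau n) y)); last first.
    by move=> y yS; rewrite pE ?(ltW h0).
  move=> semh; have psih : `|psi (tau n) -
      \sum_(y <- ktrees k n) psi y * p h (tau n) y| <= e / 3.
    by near: h.
  (* The three errors: [phi] against [psi] at [tau], the sum against its limit, and the semigroup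
     against the sum. *)
  have e3E : e = e / 3 + (e / 3 + e / 3) by field.
  rewrite [leRHS]e3E; apply: le_trans (ler_distD (psi (tau n)) _ _) _.
  apply: lerD; first exact: phipsi.
  exact: le_trans (ler_distD _ _ _) (lerD psih semh).
apply/(cvgrPdist_le (FF := nbhs_filter tau)) => e e0.
have e2 : 0 < e / 2 by rewrite divr_gt0.
have [n [psi [n0 phipsi sem]]] := approx _ e2.
apply/nbhs_ktreeP; exists n => tau' /= tautau'.
have [p pP pE] := law n n0 tau; have [p' p'P p'E] := law n n0 tau'.
have h := sem t tau (ltW t0); have h' := sem t tau' (ltW t0).
(* The two transition functions have the same rates and the chains start from the same finite tree,
   so the approximating sums coincide. *)
have E :
    \sum_(y <- ktrees k n)
       psi y * fine (P tau ((fun w => X t w n) @^-1` [set y])) =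
    \sum_(y <- ktrees k n)
       psi y * fine (P tau' ((fun w => X t w n) @^-1` [set y])).
  rewrite big_seq [RHS]big_seq; apply: eq_bigr => y yS.
  rewrite pE ?p'E ?(ltW t0)// -tautau'; congr (_ * _).
  apply: transition_function_unique pP p'P _ _ _; rewrite ?(ltW t0)//.
  exact: ktree_at_in.
rewrite -E distrC in h'; rewrite [e]splitr.
by apply: le_trans (ler_distD _ _ _) (lerD h h').
Unshelve. all: by end_near. Qed.
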